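(* Let $\mu$ be a finite Borel measure on $\mathbb{R}^d$, $0<s\leq d$, and let $x\in\mathbb{R}^d$ be such that $$\limsup_{r\to 0}\frac{\mu(B(x,r))}{r^s\ell(r)}<\infty,$$ where $\ell$ is a positive Borel function slowly varying at zero. If the average $s$-density $D_a^s\mu(x)$ of $\mu$ at $x$ exists, then $$\lim_{\varepsilon\to 0}\varepsilon\,U^{d-s+\varepsilon}\mu(x)=s\,D_a^s\mu(x).$$
   Context: $B(x,r)$ is the open ball in $\mathbb{R}^d$ with center $x$ and radius $r$, and $\|\cdot\|$ is the Euclidean norm. The limit is taken over $0<\varepsilon<s$, $\varepsilon\downarrow 0$. For $0<\alpha<d$ and a Borel measure $\mu$, $U^\alpha\mu(x):=\int_{\mathbb{R}^d}\|x-y\|^{\alpha-d}\mu(dy)$ (no multiplicative constant), so that $U^{d-s+\varepsilon}\mu(x)=\int_{\mathbb{R}^d}\|x-y\|^{\varepsilon-s}\mu(dy)$. The average $s$-density of $\mu$ at $x$ is $$D_a^s\mu(x):=\lim_{u\to 0}\frac{1}{|\log u|}\int_u^1\frac{\mu(B(x,r))}{r^s}\frac{1}{r}\,dr,$$ and it is said to exist if this limit exists (as a finite number). A positive Borel function $\ell$ on $(0,\varepsilon_0)$, $\varepsilon_0>0$, is slowly varying at $0$ if $\lim_{h\to 0}\frac{\ell(\lambda h)}{\ell(h)}=1$ for all $\lambda>0$. *)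

(* Defs.v *)
From HB Require Import structures.
From mathcomp Require Import all_boot all_order all_algebra.
From mathcomp Require Import all_classical all_reals all_analysis.
Import Order.TTheory GRing.Theory Num.Theory.
Import numFieldNormedType.Exports.

Set Implicit Arguments.
Unset Strict Implicit.
Unset Printing Implicit Defensive.

Local Open Scope classical_set_scope.
Local Open Scope ring_scope.

(* The library topology of 'rV[R]_d is that of the sup norm, which has the same
   open sets, hence the same Borel sets, as the Euclidean norm. *)
Notation borelRd R d := (g_sigma_algebraType (@open 'rV[R]_d)).

Section Potentials.
Context {R : realType} {d : nat}.

(* The library norm on 'rV[R]_d is the sup norm. *)
Definition enorm (x : 'rV[R]_d) : R := Num.sqrt (\sum_(i < d) x ord0 i ^+ 2).

Definition eball (x : 'rV[R]_d) (r : R) : set 'rV[R]_d :=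
  [set y | enorm (y - x) < r].

(* In the relevant range alpha < d the kernel is infinite on the diagonal,
   whereas the library convention is 0 `^ a = 0 for a != 0. *)
Definition riesz_kernel (alpha : R) (x y : 'rV[R]_d) : \bar R :=
  if x == y then +oo%E else (enorm (x - y) `^ (alpha - d%:R))%:E.

Definition riesz_potential (alpha : R)
    (mu : {measure set (borelRd R d) -> \bar R}) (x : 'rV[R]_d) : \bar R :=
  (\int[mu]_y riesz_kernel alpha x y)%E.

Definition log_average_density (s : R)
    (mu : {finite_measure set (borelRd R d) -> \bar R}) (x : 'rV[R]_d) (u : R) : R :=
  `|ln u|^-1 *
  \int[lebesgue_measure]_(r in `[u, 1]) (fine (mu (eball x r)) / r `^ s * r^-1).

(* As mu is finite the integrals above are finite for 0 < u < 1, so this is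
   convergence to a finite limit. *)
Definition average_density_exists (s : R)
    (mu : {finite_measure set (borelRd R d) -> \bar R}) (x : 'rV[R]_d) : Prop :=
  cvg (log_average_density s mu x u @[u --> 0^'+]).

Definition average_density (s : R)
    (mu : {finite_measure set (borelRd R d) -> \bar R}) (x : 'rV[R]_d) : R :=
  lim (log_average_density s mu x u @[u --> 0^'+]).

End Potentials.

(* Only the values of l on ]0, e0[ matter. *)
Definition slowly_varying_at0 {R : realType} (l : R -> R) : Prop :=
  exists2 e0 : R, 0 < e0 &
    [/\ forall h, h \in `]0, e0[ -> 0 < l h,
        measurable_fun `]0, e0[ l &
        forall lam, 0 < lam -> l (lam * h) / l h @[h --> 0^'+] --> (1 : R)].

(* Main.v *)
Require Import Defs.
From HB Require Import structures.
From mathcomp Require Import all_boot all_order all_algebra.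
From mathcomp Require Import all_classical all_reals all_analysis.
From mathcomp Require Import measurable_realfun ring lra.
Import Order.TTheory GRing.Theory Num.Theory.
Import numFieldNormedType.Exports.

Local Open Scope classical_set_scope.
Local Open Scope ring_scope.

(** Let phi(r) = mu(B(x,r)), f(r) = phi(r) r^(-s-1) and F(u) = int_u^1 f, so
    that F(u) / |log u| tends to the average density D.  Existence of D already
    forces mu{x} = 0, since otherwise F(u) >= c (u^(-s) - 1).  Writing
    t^(eps-s) = 1 + (s-eps) int_t^1 r^(eps-s-1) dr for t < 1 and exchanging the
    integrals gives
      U^(d-s+eps) mu(x) = O(1) + (s-eps) int_0^1 r^eps f(r) dr,
    and it remains to see that eps int_0^1 r^eps f(r) dr -> D.  Inserting
    r^eps = int_(-log r)^oo eps e^(-eps w) dw and exchanging again, this is the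
    Abelian statement that eps int_0^oo eps e^(-eps w) F(e^(-w)) dw -> D when
    F(e^(-w)) ~ D w. *)

(** * Explicit power and exponential integrals, and exchange of integrals *)

Lemma integral_powR_itv {R : realType} (a t : R) : 0 < t -> t < 1 ->
  (\int[@lebesgue_measure R]_(r in `]t, 1%R[) (a * r `^ (- a - 1))%:E =
   (t `^ (- a) - 1)%:E)%E.
Proof.
move=> t0 t1.
pose p r := a * r `^ (- a - 1).
have cp (r : R) : 0 < r -> {for r, continuous p}.
  move=> r0; apply: continuousM; first exact: cvg_cst.
  apply/differentiable_continuous/derivable1_diffP.
  by apply: derivable_powR; rewrite in_itv/= r0.
rewrite -(@integral_itv_bndoo _ t 1 (EFin \o p) true false); last first.
  apply/measurable_EFinP; apply: open_continuous_measurable_fun => //.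
  move=> r /set_mem; rewrite /= in_itv/= => /andP[tr _].
  exact/cp/(lt_trans t0).
have dP (r : R) : 0 < r -> is_derive r 1 (fun r : R => - r `^ (- a)) (p r).
  move=> r0; have := @is_derive1_powR R (- a) r r0 => H.
  by apply: is_derive_eq; rewrite /p mulNr opprK.
have cP (r : R) : 0 < r -> {for r, continuous (fun r : R => - r `^ (- a))}.
  move=> r0; apply/differentiable_continuous/derivable1_diffP.
  by have [] := dP r r0.
rewrite (@continuous_FTC2 _ p (fun r : R => - r `^ (- a)))//.
- by rewrite powR1 -EFinB opprK addrC.
- apply/continuous_within_itvP => //; split.
  + move=> r; rewrite in_itv/= => /andP[tr _]; exact/cp/(lt_trans t0).
  + by apply: cvg_at_right_filter; exact: cp.
  + by apply: cvg_at_left_filter; apply: cp.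
- split.
  + by move=> r; rewrite in_itv/= => /andP[/(lt_trans t0) /dP[]].
  + by apply: cvg_at_right_filter; exact: cP.
  + by apply: cvg_at_left_filter; apply: cP.
- move=> r; rewrite in_itv/= => /andP[/(lt_trans t0) /dP[_ E] _].
  by rewrite derive1E E.
Qed.

Lemma is_derive_scaler {R : realType} (a w : R) :
  is_derive w 1 (fun w => a * w) a.
Proof.
have := is_deriveZ a (is_derive_id w (1 : R)).
by rewrite /= /GRing.scale/= mulr1.
Qed.

Lemma is_derive_expRNM {R : realType} (a w : R) :
  is_derive w 1 (fun w : R => expR (- (a * w))) (- (a * expR (- (a * w)))).
Proof.
have H := is_deriveN (is_derive_scaler a w).
have := is_derive1_comp (f := expR) (g := fun w => - (a * w))
  (is_derive_expR (- (a * w))) H.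
by rewrite mulrN mulrC.
Qed.

Lemma cvgr_expRNM {R : realType} (a : R) : 0 < a ->
  expR (- (a * w)) @[w --> +oo] --> 0.
Proof.
move=> a0.
apply: (@cvg_comp _ _ _ (fun w => a * w) (fun z => expR (- z)) _ (pinfty_nbhs R)).
  exact: gt0_cvgMry.
exact: cvgr_expR.
Qed.

Lemma continuous_expRNM {R : realType} (a : R) :
  continuous (fun w : R => expR (- (a * w))).
Proof.
move=> w; apply/differentiable_continuous/derivable1_diffP.
by have [] := is_derive_expRNM a w.
Qed.

Lemma integral_expR_tail {R : realType} (a v : R) : 0 < a ->
  (\int[@lebesgue_measure R]_(w in `]v, +oo[) (a * expR (- (a * w)))%:E =
   (expR (- (a * v)))%:E)%E.
Proof.
move=> a0; pose p (w : R) := a * expR (- (a * w)).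
have dP (w : R) : is_derive w 1 (fun w : R => - expR (- (a * w))) (p w).
  by rewrite /p -[X in is_derive _ _ _ X]opprK; apply/is_deriveN/is_derive_expRNM.
have cp : continuous p.
  by move=> w; apply: cvgM; [exact: cvg_cst|exact: continuous_expRNM].
rewrite integral_itv_obnd_cbnd; last first.
  apply: measurable_funTS; apply/measurable_EFinP.
  exact: (continuous_measurable_fun cp).
rewrite (@ge0_continuous_FTC2y _ p (fun w : R => - expR (- (a * w))) v 0)//.
- by rewrite -EFinB sub0r opprK.
- by move=> w _; rewrite mulr_ge0 ?expR_ge0// ltW.
- exact: continuous_subspaceT.
- by rewrite -oppr0; apply: cvgN; exact: cvgr_expRNM.
- by apply: cvg_at_right_filter; apply: cvgN; exact: continuous_expRNM.
- by move=> w _; rewrite derive1E; have [_ ->] := dP w.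
Qed.

(** This is the mean of the exponential law of rate [a], rescaled by [a]. An antiderivative of the
    integrand is [- (expR (- (a * w)) * (a * w + 1))]. *)
Lemma integral_expR_mean {R : realType} (a : R) : 0 < a ->
  (\int[@lebesgue_measure R]_(w in `]0%R, +oo[) (a * expR (- (a * w)) * (a * w))%:E
   = 1)%E.
Proof.
move=> a0; pose p (w : R) := a * expR (- (a * w)) * (a * w).
pose P (w : R) := - (expR (- (a * w)) * (a * w + 1)).
have cM (w : R) : {for w, continuous (fun w : R => a * w)}.
  by apply: cvgM; [exact: cvg_cst|exact: cvg_id].
have dP (w : R) : is_derive w 1 P (p w).
  have H1 : is_derive w 1 (fun w => a * w + 1) a.
    have := is_deriveD (is_derive_scaler a w) (is_derive_cst (1 : R) w 1).
    by rewrite addr0.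
  have := is_deriveN (is_deriveM (is_derive_expRNM a w) H1).
  rewrite /GRing.scale/= => /is_derive_eq; apply.
  by rewrite /p; ring.
have cP : continuous P.
  by move=> w; apply/differentiable_continuous/derivable1_diffP; have [] := dP w.
have cp : continuous p.
  move=> w; apply: cvgM; last exact: cM.
  by apply: cvgM; [exact: cvg_cst|exact: continuous_expRNM].
rewrite integral_itv_obnd_cbnd; last first.
  apply: measurable_funTS; apply/measurable_EFinP.
  exact: (continuous_measurable_fun cp).
rewrite (@ge0_continuous_FTC2y _ p P 0 0)//.
- by rewrite /P mulr0 oppr0 expR0 mul1r add0r EFinN oppeK add0r.
- by move=> w w0; rewrite !mulr_ge0 ?expR_ge0// ltW.
- exact: continuous_subspaceT.
- rewrite -oppr0; apply: cvgN.
  (* With [z = a / 2 * w], half of the exponential decay absorbs the linear factor: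
     [1 + z <= expR z] gives [2 z + 1 <= 2 expR z]. *)
  apply: (@squeeze_cvgr _ _ _ _ (cst 0) (fun w => 2 * expR (- (a / 2 * w)))).
  + near=> w.
    have w0 : 0 <= w by near: w; exact: nbhs_pinfty_ge.
    have aw0 : 0 <= a * w by rewrite mulr_ge0// ltW.
    rewrite mulr_ge0 ?expR_ge0 ?addr_ge0//=.
    have -> : a * w = a / 2 * w + a / 2 * w by field.
    set z := a / 2 * w.
    rewrite opprD expRD -mulrA mulrC ler_pM2r ?expR_gt0//.
    rewrite -ler_pdivlMl ?expR_gt0// -expRN opprK.
    by have := expR_ge1Dx z; lra.
  + exact: cvg_cst.
  + rewrite -[X in _ --> X](mulr0 2); apply: cvgMr.
    by apply: cvgr_expRNM; rewrite divr_gt0.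
- by apply: cvg_at_right_filter; exact: cP.
- by move=> w _; rewrite derive1E; have [_ ->] := dP w.
Unshelve. all: by end_near. Qed.
(** Tonelli on the region [g t < r < 1], where [0 <= g] confines [r] to []0, 1[]. It serves both
    exchanges of the argument: with Lebesgue measure and [g w = expR (- w)], and with [mu] and
    [g y = enorm (y - x)]. *)
Lemma tonelli_above {disp} {T : measurableType disp} {R : realType}
    (m : {sigma_finite_measure set T -> \bar R}) (D : set T)
    (g : T -> R) (k : T -> \bar R) (h : R -> \bar R) :
  measurable D -> measurable_fun setT g -> measurable_fun setT k ->
  measurable_fun setT h -> (forall t, 0 <= g t) ->
  (forall t, (0 <= k t)%E) -> (forall r, (0 <= h r)%E) ->
  (\int[m]_(t in D)
     (k t * \int[@lebesgue_measure R]_(r in `]g t, 1%R[) h r) =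
   \int[@lebesgue_measure R]_(r in `]0%R, 1%R[)
     (h r * \int[m]_(t in D `&` [set t | (g t < r)%R]) k t))%E.
Proof.
move=> mD mg mk mh g0 k0 h0.
pose A := [set p : T * R | D p.1 /\ g p.1 < p.2 /\ p.2 < 1].
have mA : measurable A.
  have -> : A = (fst @^-1` D) `&` ((fun p : T * R => g p.1 < p.2) @^-1` [set true]
      `&` (fun p : T * R => p.2 < 1) @^-1` [set true]).
    by apply/seteqP; split => -[t r].
  apply: measurableI; last apply: measurableI.
  - by rewrite -[X in measurable X]setTI; exact: measurable_fst.
  - rewrite -[X in measurable X]setTI.
    apply: (measurable_fun_ltr (f := g \o fst) (g := snd)) => //.
    by apply: measurableT_comp => //; exact: measurable_fst.
  - rewrite -[X in measurable X]setTI.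
    exact: (measurable_fun_ltr (f := snd) (g := cst 1)).
(* The indicator of the region turns both iterated integrals into integrals over full spaces. *)
pose F (p : T * R) : \bar R := (k p.1 * h p.2 * (\1_A p)%:E)%E.
have mF : measurable_fun setT F.
  apply: emeasurable_funM; first apply: emeasurable_funM.
  - by apply: measurableT_comp => //; exact: measurable_fst.
  - by apply: measurableT_comp => //; exact: measurable_snd.
  - exact/measurable_EFinP/measurable_indic.
have F0 p : (0 <= F p)%E by rewrite !mule_ge0// lee_fin.
rewrite integral_mkcond [RHS]integral_mkcond.
transitivity (\int[m]_t \int[@lebesgue_measure R]_r F (t, r))%E.
  apply: eq_integral => t _; rewrite patchE; case: ifPn => [/set_mem Dt|/negP nDt].
    rewrite -ge0_integralZl//; last exact: measurable_funTS.
    rewrite integral_mkcond; apply: eq_integral => r _.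
    rewrite patchE /F indicE; case: ifPn => [/set_mem|/negP] /=.
      by rewrite in_itv/= => /andP[gr r1]; rewrite mem_set ?mule1//; split.
    move=> H; rewrite memNset ?mule0// => -[_ [/= gr r1]]; apply: H.
    by rewrite inE/= in_itv/= gr r1.
  rewrite integral0_eq// => r _; rewrite /F indicE memNset ?mule0// => -[/= Dt _].
  by apply: nDt; rewrite inE.
rewrite fubini_tonelli//.
apply: eq_integral => r _; rewrite patchE; case: ifPn => [/set_mem|/negP rI].
  rewrite /= in_itv/= => /andP[r_gt0 r_lt1].
  have mDr : measurable (D `&` [set t | g t < r]).
    apply: measurableI => //; rewrite -[X in measurable X]setTI.
    rewrite -[[set t | g t < r]]/((fun t => g t < r) @^-1` [set true]).
    exact: (measurable_fun_ltr (f := g) (g := cst r)).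
  rewrite -ge0_integralZl//; last exact: measurable_funTS.
  rewrite [RHS]integral_mkcond; apply: eq_integral => t _.
  rewrite patchE /F indicE; case: ifPn => [/set_mem|/negP] /=.
    by move=> [Dt gtr]; rewrite mem_set ?mule1 1?muleC.
  move=> H; rewrite memNset ?mule0// => -[Dt [/= gr _]]; apply: H.
  by rewrite inE.
rewrite integral0_eq// => t _; rewrite /F indicE memNset ?mule0// => -[_ [/= gr r1]].
by apply: rI; rewrite inE/= in_itv/= r1 (le_lt_trans _ gr).
Qed.

(** * The Abelian theorem for logarithmic means *)

Lemma integral_powRM_expR {R : realType} (f : R -> R) (a : R) :
  measurable_fun setT f -> (forall r, 0 <= f r) -> 0 < a ->
  (\int[@lebesgue_measure R]_(r in `]0%R, 1%R[) (r `^ a * f r)%:E =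
   \int[@lebesgue_measure R]_(w in `]0%R, +oo[) ((a * expR (- (a * w)))%:E *
     \int[@lebesgue_measure R]_(r in `](expR (- w))%R, 1%R[) (f r)%:E))%E.
Proof.
move=> mf f0 a0; rewrite tonelli_above//; last 4 first.
- have := @continuous_expRNM R 1; under eq_fun do rewrite mul1r.
  exact: continuous_measurable_fun.
- apply/measurable_EFinP; apply: measurable_funM => //.
  by apply: continuous_measurable_fun; exact: continuous_expRNM.
- exact/measurable_EFinP.
- by move=> w; rewrite lee_fin mulr_ge0 ?expR_ge0// ltW.
apply: eq_integral => r /set_mem; rewrite /= in_itv/= => /andP[r0 r1].
(* Since [r < 1], the bound [w > - ln r] already contains [w > 0]; the exponential tail beyond
   [- ln r] is then [r] to the power [a]. *)
have -> : `]0, +oo[ `&` [set w | expR (- w) < r] = `]- ln r, +oo[%classic.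
  have lnr0 : ln r < 0 by rewrite ln_lt0// r0.
  apply/seteqP; split => w /=; rewrite !in_itv/= !andbT.
    by move=> [_]; rewrite -{1}(lnK r0) ltr_expR ltrNl.
  move=> rw; split; first by rewrite (lt_trans _ rw)// oppr_gt0.
  by rewrite -(lnK r0) ltr_expR ltrNl.
rewrite integral_expR_tail// -EFinM mulrN opprK mulrC; congr (_ * _)%:E.
by rewrite /powR gt_eqF.
Qed.

(** The limit gives the two linear bounds for large [w]. On the remaining bounded range of [w],
    monotonicity bounds [F (expR (- w))], and the constant [K] absorbs the discrepancy. *)
Lemma log_mean_bounds {R : realType} (F : R -> R) (D e : R) :
  (forall u, 0 <= F u) -> (forall u v, 0 < u -> u <= v -> F v <= F u) -> 0 < e ->
  `|ln u|^-1 * F u @[u --> 0^'+] --> D ->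
  exists2 K, 0 <= K & forall w, 0 < w ->
    (D - e) * w - K <= F (expR (- w)) <= (D + e) * w + K.
Proof.
move=> F0 ndF e0 FD.
have D0 : 0 <= D.
  apply: (cvgr_to_ge FD); near=> u; first by rewrite mulr_ge0// invr_ge0.
have /cvgrPdist_lt/(_ e e0) := FD.
move=> [d /= d0 Hd].
(* Beyond [w1] the point [expR (- w)] lies within the distance [d] of 0 supplied by the limit; the
   maximum with 1 keeps [w1] positive. *)
pose w1 := Num.max 1 (- ln (d / 2)).
have w10 : 0 < w1 by rewrite lt_max ltr01.
(* For [w <= w1] the first term dominates [F (expR (- w))], and the second dominates [(D - e) * w],
   so that the lower bound is nonpositive there. *)
exists (F (expR (- w1)) + (D + e) * w1) => [|w w0].
  by rewrite addr_ge0// mulr_ge0 ?(ltW w10)// addr_ge0// ltW.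
have De : 0 < D + e by rewrite ltr_wpDl.
have [ww1|w1w] := leP w w1.
  have F1 : F (expR (- w)) <= F (expR (- w1)).
    by apply: ndF; rewrite ?expR_gt0// ler_expR lerN2.
  have F2 := F0 (expR (- w)); have F3 := F0 (expR (- w1)).
  by apply/andP; split; nra.
have ed : expR (- w) < d.
  have d2 : 0 < d / 2 by rewrite divr_gt0.
  apply: (@lt_trans _ _ (d / 2)); last by lra.
  rewrite -[ltRHS](lnK d2) ltr_expR ltrNl (le_lt_trans _ w1w)//.
  by rewrite le_max lexx orbT.
have := Hd (expR (- w)).
rewrite /= sub0r normrN gtr0_norm ?expR_gt0// => /(_ ed isT).
rewrite expRK normrN (gtr0_norm w0) [_^-1 * _]mulrC.
have F1 := F0 (expR (- w)); have F3 := F0 (expR (- w1)).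
rewrite ltr_norml => /andP[H1 H2].
have H3 : F (expR (- w)) = F (expR (- w)) / w * w by rewrite divfK ?gt_eqF.
have K0 : 0 <= F (expR (- w1)) + (D + e) * w1.
  by rewrite addr_ge0// mulr_ge0 ?(ltW w10)// ltW.
by rewrite H3; apply/andP; split; nra.
Unshelve. all: by end_near. Qed.

(** By [integral_powRM_expR], [a * J] is the integral of [a * k w * F (expR (- w))] with the
    exponential density [k w = a * expR (- (a * w))]. Since [k w] and [k w * (a * w)] both have
    integral 1, an affine bound of slope [b] and constant [K] integrates to [b] and [a * K]. *)
Lemma abel_bounds {R : realType} (f F : R -> R) (a b K : R) :
  measurable_fun setT f -> (forall r, 0 <= f r) ->
  (forall u, 0 <= F u) -> (forall u v, 0 < u -> u <= v -> F v <= F u) ->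
  (forall u : R, 0 < u ->
    (\int[@lebesgue_measure R]_(r in `]u, 1%R[) (f r)%:E = (F u)%:E)%E) ->
  0 < a -> 0 <= K ->
  let J := (\int[@lebesgue_measure R]_(r in `]0%R, 1%R[) (r `^ a * f r)%:E)%E in
  ((0 <= b -> (forall w, 0 < w -> F (expR (- w)) <= b * w + K) ->
    (a%:E * J <= (b + a * K)%:E)%E) /\
  ((forall w, 0 < w -> b * w - K <= F (expR (- w))) ->
    ((b - a * K)%:E <= a%:E * J)%E)).
Proof.
move=> mf f0 F0 ndF FE a0 K0 J.
pose k (w : R) := a * expR (- (a * w)).
have k0 w : 0 <= k w by rewrite mulr_ge0 ?expR_ge0// ltW.
have mk : measurable_fun setT k.
  apply: measurable_funM => //.
  by apply: continuous_measurable_fun; exact: continuous_expRNM.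
have mFe : measurable_fun setT (fun w : R => F (expR (- w))).
  apply: nondecreasing_measurable => // u v uv.
  by apply: ndF; rewrite ?expR_gt0// ler_expR lerN2.
have aJE : (a%:E * J = \int[@lebesgue_measure R]_(w in `]0%R, +oo[)
    (a * (k w * F (expR (- w))))%:E)%E.
  rewrite /J integral_powRM_expR//.
  under [RHS]eq_integral do rewrite EFinM.
  rewrite ge0_integralZl//; last 3 first.
  - exact/measurable_funTS/measurable_EFinP/measurable_funM.
  - by move=> w _; rewrite lee_fin mulr_ge0.
  - by rewrite lee_fin ltW.
  congr (_ * _)%E; apply: eq_integral => w _.
  by rewrite FE ?expR_gt0// -EFinM.
have I1 (c : R) : 0 <= c -> (\int[@lebesgue_measure R]_(w in `]0%R, +oo[)
    (c * (k w * (a * w)))%:E = c%:E)%E.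
  move=> c0; under eq_integral do rewrite EFinM.
  rewrite ge0_integralZl//; last 2 first.
  - exact/measurable_funTS/measurable_EFinP/measurable_funM.
  - move=> w; rewrite /= in_itv/= andbT => w0.
    by rewrite lee_fin !mulr_ge0// ltW.
  by rewrite integral_expR_mean// mule1.
have I2 (c : R) : 0 <= c -> (\int[@lebesgue_measure R]_(w in `]0%R, +oo[)
    (c * k w)%:E = c%:E)%E.
  move=> c0; under eq_integral do rewrite EFinM.
  rewrite ge0_integralZl//; last 2 first.
  - exact/measurable_funTS/measurable_EFinP.
  - by move=> w _; rewrite lee_fin.
  by rewrite integral_expR_tail// mulr0 oppr0 expR0 mule1.
have aK0 : 0 <= a * K by rewrite mulr_ge0// ltW.
have mI1 (c : R) : measurable_fun (`]0, +oo[%classic : set R)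
    (fun w : R => (c * (k w * (a * w)))%:E).
  apply/measurable_funTS/measurable_EFinP/measurable_funM => //.
  by apply: measurable_funM => //; exact: measurable_funM.
have mI2 (c : R) : measurable_fun (`]0, +oo[%classic : set R)
    (fun w : R => (c * k w)%:E).
  exact/measurable_funTS/measurable_EFinP/measurable_funM.
have mI3 : measurable_fun (`]0, +oo[%classic : set R)
    (fun w : R => (a * (k w * F (expR (- w))))%:E).
  apply/measurable_funTS/measurable_EFinP/measurable_funM => //.
  exact: measurable_funM.
split=> [b0 FK|FK].
  rewrite EFinD -[in leRHS](I1 _ b0) -[in leRHS](I2 _ aK0) aJE.
  rewrite -ge0_integralD//; last 4 first.
  - move=> w; rewrite /= in_itv/= andbT => w0.
    by rewrite lee_fin !mulr_ge0// ltW.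
  - exact: mI1.
  - by move=> w _; rewrite lee_fin mulr_ge0.
  - exact: mI2.
  apply: ge0_le_integral => //.
  - by move=> w _; rewrite lee_fin !mulr_ge0// ltW.
  - exact: (emeasurable_funD (mI1 _) (mI2 _)).
  - move=> w; rewrite /= in_itv/= andbT => w0.
    rewrite -EFinD lee_fin.
    have -> : b * (k w * (a * w)) + a * K * k w = a * (k w * (b * w + K)) by ring.
    by rewrite ler_pM2l// ler_wpM2l// FK.
(* The slope may be negative here; the lower bound is then nonpositive and hence trivial. *)
have [b0|b0] := leP b 0.
  apply: (@le_trans _ _ 0%E); first by rewrite lee_fin; lra.
  rewrite aJE; apply: integral_ge0 => w _.
  by rewrite lee_fin !mulr_ge0// ltW.
(* The term [a * K] moves to the right, so that only nonnegative integrands are compared. *)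
rewrite EFinB leeBlDr// -[in leLHS](I1 _ (ltW b0)) -[in leRHS](I2 _ aK0) aJE.
rewrite -ge0_integralD//; last 3 first.
- by move=> w _; rewrite lee_fin !mulr_ge0// ltW.
- by move=> w _; rewrite lee_fin mulr_ge0.
- exact: mI2.
apply: ge0_le_integral => //.
- move=> w; rewrite /= in_itv/= andbT => w0.
  by rewrite lee_fin !mulr_ge0// ltW.
- exact: mI1.
- exact: (emeasurable_funD mI3 (mI2 _)).
move=> w; rewrite /= in_itv/= andbT => w0.
rewrite -EFinD lee_fin.
have -> : b * (k w * (a * w)) = a * (k w * (b * w)) by ring.
have -> : a * (k w * F (expR (- w))) + a * K * k w =
  a * (k w * (F (expR (- w)) + K)) by ring.
by rewrite ler_pM2l// ler_wpM2l// -lerBlDr FK.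
Qed.

(** The constant [K] depends on the tolerance [e] but enters only as [a * K], so it vanishes as [a]
    tends to 0 for each fixed [e]. *)
Lemma abel_log_mean {R : realType} (f F : R -> R) (D : R) :
  measurable_fun setT f -> (forall r, 0 <= f r) ->
  (forall u, 0 <= F u) -> (forall u v, 0 < u -> u <= v -> F v <= F u) ->
  (forall u : R, 0 < u ->
    (\int[@lebesgue_measure R]_(r in `]u, 1%R[) (f r)%:E = (F u)%:E)%E) ->
  `|ln u|^-1 * F u @[u --> 0^'+] --> D ->
  (a%:E * \int[@lebesgue_measure R]_(r in `]0%R, 1%R[) (r `^ a * f r)%:E)%E
    @[a --> (0 : R)^'+] --> D%:E.
Proof.
move=> mf f0 F0 ndF FE FD.
have D0 : 0 <= D.
  apply: (cvgr_to_ge FD); near=> u.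
  by rewrite mulr_ge0// invr_ge0.
have bounds e : 0 < e -> exists2 K, 0 <= K & forall a, 0 < a ->
    ((D - e - a * K)%:E <=
     a%:E * \int[@lebesgue_measure R]_(r in `]0%R, 1%R[) (r `^ a * f r)%:E <=
     (D + e + a * K)%:E)%E.
  move=> e0; have [K K0 HK] := log_mean_bounds F D e F0 ndF e0 FD.
  exists K => // a a0; apply/andP; split.
    have [_ +] := @abel_bounds R f F a (D - e) K mf f0 F0 ndF FE a0 K0.
    by apply => w w0; have /andP[] := HK w w0.
  have [+ _] := @abel_bounds R f F a (D + e) K mf f0 F0 ndF FE a0 K0.
  apply; first by rewrite addr_ge0// ltW.
  by move=> w w0; have /andP[] := HK w w0.
apply/fine_cvgP; split.
  (* Convergence to a finite value in the extended reals includes eventual finiteness; any fixed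
     tolerance gives it. *)
  have [K K0 HK] := bounds 1 ltr01.
  near=> a; have a0 : 0 < a by [].
  have /andP[H1 H2] := HK a a0.
  by rewrite fin_numElt (lt_le_trans _ H1) ?ltNyr// (le_lt_trans H2) ?ltry.
apply/cvgrPdist_le => e e0.
have [|K K0 HK] := bounds (e / 2); first by rewrite divr_gt0.
(* Dividing by [K + 1] rather than by [K] covers [K = 0]. *)
have K1 : 0 < K + 1 by lra.
near=> a.
have a0 : 0 < a by [].
have aK : a * K <= e / 2.
  have : a * (K + 1) <= e / 2.
    by rewrite -ler_pdivlMr//; near: a; apply: nbhs_right_le; rewrite divr_gt0 ?divr_gt0.
  by lra.
have := HK a a0.
set x := (_ * _)%E => /andP[H1 H2].
have xfin : x \is a fin_num.
  by rewrite fin_numElt (lt_le_trans _ H1) ?ltNyr// (le_lt_trans H2) ?ltry.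
move: H1 H2; rewrite -(fineK xfin) /= !lee_fin => H1 H2.
by rewrite ler_norml; apply/andP; split; lra.
Unshelve. all: by end_near. Qed.

(** * The Euclidean norm and measurability of balls and points *)

Section euclidean_norm.
Context {R : realType} {d : nat}.
Implicit Types x y : 'rV[R]_d.

Lemma enorm_ge0 x : 0 <= enorm x.
Proof. exact: sqrtr_ge0. Qed.

Lemma enorm_subC x y : enorm (x - y) = enorm (y - x).
Proof.
by rewrite /enorm; congr Num.sqrt; apply: eq_bigr => i _; rewrite !mxE; ring.
Qed.

Lemma enorm_eq0 x : (enorm x == 0) = (x == 0).
Proof.
have sq0 : 0 <= \sum_(i < d) x ord0 i ^+ 2 by apply: sumr_ge0 => i _; exact: sqr_ge0.
apply/idP/eqP => [|->]; last first.
  by rewrite /enorm big1 ?sqrtr0// => i _; rewrite mxE expr0n.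
rewrite sqrtr_eq0 => le0; have /eqP : \sum_(i < d) x ord0 i ^+ 2 = 0.
  by apply/le_anti/andP.
rewrite psumr_eq0 => [/allP H|i _]; last exact: sqr_ge0.
apply/rowP => i; rewrite mxE; apply/eqP; rewrite -sqrf_eq0.
by have := H i; rewrite mem_index_enum => /(_ isT).
Qed.

(** Open intervals generate the Borel sets of the line, and their preimages under a continuous
    coordinate are open. *)
Lemma measurable_coord (i : 'I_d) :
  measurable_fun [set: borelRd R d] (fun y : borelRd R d => (y : 'rV[R]_d) ord0 i).
Proof.
apply: (measurability _ (RGenOpens.measurableE R)) => _ [_ [a [b ->]] <-].
rewrite setTI; apply: sub_sigma_algebra.
exact: (open_comp (fun y _ => @coord_continuous R 1 d ord0 i y) (interval_open _ _)).
Qed.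

Lemma measurable_enorm_sub x :
  measurable_fun [set: borelRd R d] (fun y : borelRd R d => enorm ((y : 'rV[R]_d) - x)).
Proof.
rewrite /enorm; apply: (measurableT_comp (f := @Num.sqrt R)).
  by apply: continuous_measurable_fun; exact: sqrt_continuous.
apply: measurable_sum => i; apply: measurable_funX.
under eq_fun do rewrite !mxE.
apply: measurable_funB => //; exact: measurable_coord.
Qed.

Lemma measurable_eball x r : measurable (eball x r : set (borelRd R d)).
Proof.
have -> : eball x r = (fun y => enorm (y - x) < r) @^-1` [set true] by [].
rewrite -[X in measurable X]setTI.
by apply: (measurable_fun_ltr (g := cst r)) => //; exact: measurable_enorm_sub.
Qed.

Lemma measurable_point x : measurable ([set x] : set (borelRd R d)).
Proof.
have -> : [set x] = [set: borelRd R d] `&` (fun y => enorm (y - x)) @^-1` [set 0].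
  rewrite setTI; apply/seteqP; split => y /=.
    by move=> ->; apply/eqP; rewrite enorm_eq0 subrr.
  by move=> /eqP; rewrite enorm_eq0 subr_eq0 => /eqP.
exact: measurable_enorm_sub.
Qed.

End euclidean_norm.

(** * Ball masses, the logarithmic integral, and absence of an atom at [x] *)

Section radial_density.
Context {R : realType} {d : nat}.
Variables (mu : {finite_measure set (borelRd R d) -> \bar R}) (s : R) (x : 'rV[R]_d).
Hypothesis s_gt0 : 0 < s.

Definition ball_mass (r : R) : R := fine (mu (eball x r)).
Definition radial_density (r : R) : R := ball_mass r * r `^ (- s - 1).
Definition density_tail (u : R) : R :=
  \int[@lebesgue_measure R]_(r in `]u, 1[) radial_density r.

Local Notation phi := ball_mass.
Local Notation f := radial_density.
Local Notation F := density_tail.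

Lemma ball_mass_ge0 r : 0 <= phi r.
Proof. by apply: fine_ge0; exact: measure_ge0. Qed.

Lemma ball_mass_le r q : r <= q -> phi r <= phi q.
Proof.
move=> rq; apply: fine_le.
- by apply: fin_num_measure; exact: measurable_eball.
- by apply: fin_num_measure; exact: measurable_eball.
apply: le_measure; rewrite ?inE; [exact: measurable_eball|exact: measurable_eball|].
by move=> y /= /lt_le_trans; apply.
Qed.

Lemma ball_mass_leT r : phi r <= fine (mu setT).
Proof.
apply: fine_le.
- by apply: fin_num_measure; exact: measurable_eball.
- exact: fin_num_measure.
by apply: le_measure; rewrite ?inE//; exact: measurable_eball.
Qed.

Lemma radial_density_ge0 r : 0 <= f r.
Proof. by rewrite mulr_ge0 ?ball_mass_ge0 ?powR_ge0. Qed.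

Lemma measurable_radial_density : measurable_fun setT f.
Proof.
apply: measurable_funM; last exact: measurable_powR.
by apply: nondecreasing_measurable => // r q; exact: ball_mass_le.
Qed.

(** The content is finiteness, as [Rintegral] takes the real part of an extended integral: ball
    masses are at most the total mass, and [r] to the power [- s - 1] is integrable on []u, 1[]. *)
Lemma density_tail_EFin u : 0 < u ->
  (\int[@lebesgue_measure R]_(r in `]u, 1%R[) (f r)%:E = (F u)%:E)%E.
Proof.
move=> u0; rewrite /F /Rintegral fineK//.
have [u1|u1] := ltP u 1; last first.
  by rewrite set_itv_ge ?integral_set0// bnd_simp -leNgt.
have ge0I : (0 <= \int[@lebesgue_measure R]_(r in `]u, 1%R[) (f r)%:E)%E.
  by apply: integral_ge0 => r _; rewrite lee_fin radial_density_ge0.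
rewrite ge0_fin_numE//.
pose c := fine (mu setT) / s.
apply: (@le_lt_trans _ _ (c%:E * \int[@lebesgue_measure R]_(r in `]u, 1%R[)
    (s * r `^ (- s - 1))%:E)%E); last first.
  by rewrite integral_powR_itv// -EFinM ltry.
have mp : measurable_fun `]u, 1[%classic (fun r : R => (s * r `^ (- s - 1))%:E).
  exact/measurable_funTS/measurable_EFinP/measurable_funM.
have c0 : 0 <= c by rewrite divr_ge0 ?(ltW s_gt0)// fine_ge0.
rewrite -ge0_integralZl//; last first.
  by move=> r _; rewrite lee_fin mulr_ge0 ?powR_ge0// ltW.
apply: ge0_le_integral => //.
- by move=> r _; rewrite lee_fin radial_density_ge0.
- by apply/measurable_funTS/measurable_EFinP; exact: measurable_radial_density.
- by apply: emeasurable_funM.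
move=> r _; rewrite -EFinM lee_fin /c mulrA divfK ?gt_eqF//.
by rewrite ler_wpM2r ?powR_ge0// ball_mass_leT.
Qed.

Lemma density_tail_ge0 u : 0 <= F u.
Proof. by apply: Rintegral_ge0 => r _; exact: radial_density_ge0. Qed.

Lemma density_tail_le u v : 0 < u -> u <= v -> F v <= F u.
Proof.
move=> u0 uv; rewrite -lee_fin -!density_tail_EFin//; last exact: lt_le_trans uv.
apply: ge0_subset_integral => //.
- by apply/measurable_funTS/measurable_EFinP; exact: measurable_radial_density.
- by move=> r _; rewrite lee_fin radial_density_ge0.
- by move=> r /=; rewrite !in_itv/= => /andP[/(le_lt_trans uv) -> ->].
Qed.

(** The integrands agree for positive [r], and the endpoints of the closed interval are Lebesgue
    null. *)
Lemma log_average_densityE u : 0 < u ->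
  log_average_density s mu x u = `|ln u|^-1 * F u.
Proof.
move=> u0; rewrite /log_average_density; congr (_ * _).
have fE : {in `]u, 1[, forall r, fine (mu (eball x r)) / r `^ s * r^-1 = f r}.
  move=> r; rewrite in_itv/= => /andP[/(lt_trans u0) r0 _].
  rewrite /f /phi powRD; last by apply/implyP => _; rewrite gt_eqF.
  by rewrite powRN powR_inv1 ?ltW// mulrA.
rewrite /F /Rintegral; congr fine.
rewrite integral_itv_bndoo.
  by apply: eq_integral => r /set_mem /fE ->.
apply: (eq_measurable_fun (EFin \o f)) => [r /set_mem /fE -> //|].
by apply/measurable_funTS/measurable_EFinP; exact: measurable_radial_density.
Qed.

(** Exponential against linear growth: a point mass [m] forces [s * F (expR (- w)) >= m * (expR (s *
    w) - 1)], while [log_mean_bounds] keeps [F (expR (- w))] below an affine function of [w]. *)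
Lemma density_point_null (D : R) :
  `|ln u|^-1 * F u @[u --> 0^'+] --> D -> mu [set x] = 0%E.
Proof.
move=> FD.
have [K K0 HK] := log_mean_bounds F D 1 density_tail_ge0 density_tail_le ltr01 FD.
pose m := fine (mu [set x]).
have mE : mu [set x] = m%:E.
  by rewrite fineK// fin_num_measure//; exact: measurable_point.
have m0 : 0 <= m by apply: fine_ge0; exact: measure_ge0.
have m_le r : 0 < r -> m <= phi r.
  move=> r0; apply: fine_le.
  - by apply: fin_num_measure; exact: measurable_point.
  - by apply: fin_num_measure; exact: measurable_eball.
  apply: le_measure; rewrite ?inE; [exact: measurable_point|exact: measurable_eball|].
  by move=> y /= ->; rewrite /eball/= subrr (eqP (etrans (enorm_eq0 0) (eqxx _))).
have mF w : 0 < w -> m * (expR (s * w) - 1) <= s * F (expR (- w)).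
  move=> w0; rewrite -lee_fin [in leRHS]EFinM -density_tail_EFin ?expR_gt0//.
  have e1 : expR (- w) < 1 by rewrite expR_lt1 oppr_lt0.
  have -> : expR (s * w) = expR (- w) `^ (- s).
    by rewrite -expRM mulrNN mulrC.
  rewrite EFinM -integral_powR_itv ?expR_gt0//.
  rewrite -!ge0_integralZl ?lee_fin ?(ltW s_gt0)//; last 4 first.
  - by apply/measurable_funTS/measurable_EFinP; exact: measurable_radial_density.
  - by move=> r _; rewrite lee_fin radial_density_ge0.
  - exact/measurable_funTS/measurable_EFinP/measurable_funM.
  - by move=> r _; rewrite lee_fin mulr_ge0 ?powR_ge0// ltW.
  apply: ge0_le_integral => //.
  - by move=> r _; rewrite -EFinM lee_fin !mulr_ge0 ?powR_ge0// ltW.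
  - apply/measurable_funTS/measurable_EFinP/measurable_funM => //.
    by apply: measurable_funM => //; exact: measurable_powR.
  - apply/measurable_funTS/measurable_EFinP/measurable_funM => //.
    exact: measurable_radial_density.
  move=> r; rewrite /= in_itv/= => /andP[er _].
  rewrite -!EFinM lee_fin mulrCA ler_pM2l// ler_wpM2r ?powR_ge0//.
  by apply: m_le; rewrite (lt_trans _ er)// expR_gt0.
(* The quadratic term of the exponential is enough to beat a linear bound. *)
have growth w : 0 < w -> m * ((s * w) ^+ 2 / 2) <= s * ((D + 1) * w + K).
  move=> w0; apply: (@le_trans _ _ (m * (expR (s * w) - 1))).
    rewrite ler_wpM2l// lerBrDl.
    by apply: (expR_ge1Dxn 1); rewrite mulr_ge0// ltW.
  apply: (le_trans (mF w w0)); rewrite ler_pM2l//.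
  by have /andP[] := HK w w0.
rewrite mE; congr EFin; apply/eqP; rewrite eq_le m0 andbT leNgt; apply/negP => mgt0.
(* For [w >= 1] the affine bound is at most [c * w]. The choice of [w] below makes [m * s * w / 2]
   equal to [m * s / 2 + c], which exceeds [c] and contradicts [growth]. *)
pose c := `|D| + 1 + K.
have c0 : 0 < c by rewrite /c; have := normr_ge0 D; lra.
pose w := 1 + 2 * c / (m * s).
have w1 : 1 < w by rewrite /w ltrDl divr_gt0 ?mulr_gt0.
have w0 : 0 < w by lra.
have := growth w w0; rewrite leNgt => /negP; apply.
have -> : m * ((s * w) ^+ 2 / 2) = s * ((m * s) * w / 2 * w) by field.
rewrite ltr_pM2l//; apply: (@le_lt_trans _ _ (c * w)).
  by rewrite /c; have := ler_norm D; nra.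
rewrite ltr_pM2r//.
have -> : m * s * w / 2 = m * s / 2 + c by rewrite /w; field; rewrite !gt_eqF.
by rewrite ltrDr divr_gt0// mulr_gt0.
Qed.

End radial_density.

(** * Comparison of the Riesz potential with the radial integral *)

Lemma integral_riesz_kernel {R : realType} {d : nat}
    (mu : {finite_measure set (borelRd R d) -> \bar R}) (x : 'rV[R]_d) (a : R) :
  mu [set x] = 0%E ->
  riesz_potential (d%:R - a) mu x =
  (\int[mu]_(y in ~` [set x] : set (borelRd R d)) (enorm (y - x) `^ (- a))%:E)%E.
Proof.
move=> mux0; rewrite /riesz_potential.
have mx : measurable ([set x] : set (borelRd R d)) by exact: measurable_point.
have mCx : measurable (~` [set x] : set (borelRd R d)) by exact: measurableC.
have kE : {in (~` [set x] : set (borelRd R d)), forall y,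
    riesz_kernel (d%:R - a) x y = (enorm (y - x) `^ (- a))%:E}.
  move=> y /set_mem/= yx; rewrite /riesz_kernel ifF; last by apply/eqP => xy; apply: yx.
  by rewrite enorm_subC addrAC subrr add0r.
have mk : measurable_fun (~` [set x] : set (borelRd R d))
    (fun y => riesz_kernel (d%:R - a) x y).
  apply: (eq_measurable_fun (fun y : borelRd R d => (enorm (y - x) `^ (- a))%:E)).
    by move=> y /kE ->.
  apply/measurable_funTS/measurable_EFinP.
  apply: (measurableT_comp (f := fun t : R => t `^ (- a))).
    exact: measurable_powR.
  exact: measurable_enorm_sub.
(* The kernel is infinite at [x], but [x] is null, so this value contributes nothing. *)
rewrite -[[set: borelRd R d]](setUv [set x]) ge0_integral_setU//; last 3 first.
- by apply/measurable_funU => //; split => //; exact: measurable_fun_set1.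
- move=> y _; rewrite /riesz_kernel; case: ifP => // _.
  by rewrite lee_fin powR_ge0.
- by rewrite disj_set2E setICr.
rewrite [X in (X + _)%E]null_set_integral//; last exact: measurable_fun_set1.
by rewrite add0e; apply: eq_integral => y /kE.
Qed.

(** With [a = s - eps], the function [G] below satisfies [G t <= t ^ (- a) <= 1 + G t] for [t > 0],
    and [G (enorm (y - x))] integrates exactly to [aJ]. The bounded error is thus at most the total
    mass, uniformly in [eps]. *)
Lemma riesz_potential_bounds {R : realType} {d : nat}
    (mu : {finite_measure set (borelRd R d) -> \bar R}) (s eps : R) (x : 'rV[R]_d) :
  mu [set x] = 0%E -> 0 < eps -> eps < s ->
  let aJ := ((s - eps)%:E * \int[@lebesgue_measure R]_(r in `]0%R, 1%R[)
    (r `^ eps * radial_density mu s x r)%:E)%E in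
  (aJ <= riesz_potential (d%:R - s + eps) mu x)%E /\
  (riesz_potential (d%:R - s + eps) mu x <= mu setT + aJ)%E.
Proof.
move=> mux0 eps0 epss aJ; pose a := s - eps.
have a0 : 0 < a by rewrite subr_gt0.
have -> : d%:R - s + eps = d%:R - a by rewrite /a opprB addrA addrAC.
rewrite integral_riesz_kernel//.
pose D : set (borelRd R d) := ~` [set x].
have mD : measurable D by apply: measurableC; exact: measurable_point.
(* For every [t > 0] this is the integral of [a * r ^ (- a - 1)] over []t, 1[], an empty interval
   when [t >= 1]. *)
pose G (t : R) : R := if t < 1 then t `^ (- a) - 1 else 0.
have rho0 y : D y -> 0 < enorm (y - x).
  move=> yx; rewrite lt_neqAle enorm_ge0 andbT eq_sym enorm_eq0 subr_eq0.
  by apply/eqP => /yx.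
have G0 y : D y -> 0 <= G (enorm (y - x)).
  move=> /rho0 y0; rewrite /G; case: ifPn => // y1.
  by rewrite subr_ge0 -(powRr0 (enorm (y - x))) ger_powR ?y0 ?ltW// oppr_lt0.
have mrho := measurable_enorm_sub x.
have mGrho : measurable_fun D (fun y => (G (enorm (y - x)))%:E).
  apply/measurable_funTS/measurable_EFinP/(measurableT_comp (f := G)) => //.
  apply: measurable_fun_ifT => //.
  - exact: measurable_fun_ltr.
  - exact: measurable_funB.
have mprho : measurable_fun D (fun y => (enorm (y - x) `^ (- a))%:E).
  apply/measurable_funTS/measurable_EFinP.
  exact: (measurableT_comp (f := fun t : R => t `^ (- a))).
have aJE : (\int[mu]_(y in D) (G (enorm (y - x)))%:E = aJ)%E.
  transitivity (\int[mu]_(y in D) (cst 1 y * \int[@lebesgue_measure R]_(r in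
     `](enorm (y - x)), 1%R[) (a * r `^ (- a - 1))%:E))%E.
    apply: eq_integral => y /set_mem/rho0 y0; rewrite mul1e /G.
    have [y1|y1] := ltP; first by rewrite integral_powR_itv.
    by rewrite set_itv_ge ?integral_set0// bnd_simp -leNgt.
  rewrite tonelli_above//; last 3 first.
  - exact/measurable_EFinP/measurable_funM.
  - by move=> y; exact: enorm_ge0.
  - by move=> r; rewrite lee_fin mulr_ge0 ?powR_ge0// ltW.
  rewrite /aJ -ge0_integralZl//; last 3 first.
  - apply/measurable_funTS/measurable_EFinP/measurable_funM => //.
    exact: measurable_radial_density.
  - by move=> r _; rewrite lee_fin mulr_ge0 ?powR_ge0// radial_density_ge0.
  - by rewrite lee_fin ltW.
  apply: eq_integral => r /set_mem; rewrite /= in_itv/= => /andP[r0 r1].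
  have mball : measurable (D `&` [set y | enorm (y - x) < r]).
    by apply: measurableI => //; exact: measurable_eball.
  (* The exchange produces the ball without its centre, which has the mass of the ball because the
     centre is null. *)
  have muE : mu (D `&` [set y | enorm (y - x) < r]) = (ball_mass mu x r)%:E.
    rewrite /ball_mass fineK; last by apply: fin_num_measure; exact: measurable_eball.
    rewrite setIC -setDE measureD//=; last 3 first.
    + exact: measurable_eball.
    + exact: measurable_point.
    + by rewrite ltey_eq fin_num_measure//; exact: measurable_eball.
    rewrite [X in (_ - X)%E](_ : _ = 0%E) ?sube0//.
    apply: (subset_measure0 _ _ _ mux0) => //.
    + by apply: measurableI; [exact: measurable_eball|exact: measurable_point].
    + exact: measurable_point.
  rewrite integral_cst// mul1e [X in (_ * X)%E](_ : _ = (ball_mass mu x r)%:E)//.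
  rewrite -!EFinM; congr EFin; rewrite /radial_density.
  (* Splitting the exponent isolates the weight [r ^ eps] from the power occurring in
     [radial_density]. *)
  have -> : - a - 1 = eps + (- s - 1) by rewrite /a; ring.
  rewrite powRD; last by apply/implyP => _; rewrite gt_eqF.
  by rewrite /a; ring.
split; rewrite -aJE.
  apply: ge0_le_integral => //.
  move=> y _; rewrite lee_fin /G; case: ifP => _; last exact: powR_ge0.
  by rewrite gerDl oppr_le0.
apply: (@le_trans _ _ (\int[mu]_(y in D) (1 + (G (enorm (y - x)))%:E))%E).
  apply: ge0_le_integral => //.
  - by move=> y _; rewrite lee_fin powR_ge0.
  - exact: emeasurable_funD.
  move=> y /rho0 y0; rewrite -EFinD lee_fin /G; case: ltP => y1; first lra.
  rewrite addr0 -[leRHS](powRr0 (enorm (y - x))) ler_powR//.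
  by rewrite oppr_le0 ltW.
rewrite ge0_integralD// leeD2r// integral_cst// mul1e.
by apply: le_measure; rewrite ?inE.
Qed.

(** * Passage to the limit by squeezing *)

Theorem lemma4p7 (R : realType) (d : nat)
    (mu : {finite_measure set (borelRd R d) -> \bar R})
    (s : R) (x : 'rV[R]_d) (l : R -> R)
    (s_gt0 : 0 < s) (s_led : s <= d%:R)
    (l_sv : slowly_varying_at0 l)
    (mu_limsup : (limf_esup (fun r : R => mu (eball x r) * ((r `^ s * l r)^-1)%:E)
                    (0 : R)^'+ < +oo)%E)
    (mu_density : average_density_exists s mu x) :
  (eps%:E * riesz_potential (d%:R - s + eps) mu x)%E @[eps --> (0 : R)^'+]
    --> (s * average_density s mu x)%:E.
Proof.
set D := average_density s mu x.
have FD : `|ln u|^-1 * density_tail mu s x u @[u --> 0^'+] --> D.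
  apply: cvg_trans mu_density; apply: near_eq_cvg; near=> u.
  by rewrite log_average_densityE.
have mux0 := density_point_null mu s x s_gt0 D FD.
pose J a := (\int[@lebesgue_measure R]_(r in `]0%R, 1%R[)
  (r `^ a * radial_density mu s x r)%:E)%E.
have JD : (a%:E * J a)%E @[a --> (0 : R)^'+] --> D%:E.
  apply: (abel_log_mean _ _ _ _ _ _ _ _ FD).
  - exact: measurable_radial_density.
  - exact: radial_density_ge0.
  - exact: density_tail_ge0.
  - exact: density_tail_le.
  - exact: density_tail_EFin.
(* The factor [s] of the limit comes from the coefficient [s - a] of the radial integral. *)
have main : ((s - a)%:E * (a%:E * J a))%E @[a --> (0 : R)^'+] --> (s * D)%:E.
  rewrite EFinM; apply: cvgeM => //.
  apply: cvg_EFin; first exact: nearW.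
  rewrite -[X in _ --> X]subr0; apply: cvgB; first exact: cvg_cst.
  by apply: cvg_at_right_filter; exact: cvg_id.
pose M := fine (mu setT).
have ME : mu setT = M%:E by rewrite fineK// fin_num_measure.
apply: (@squeeze_cvge _ _ _ _ (fun a => (s - a)%:E * (a%:E * J a))%E _
  (fun a => (a * M)%:E + (s - a)%:E * (a%:E * J a))%E _ _ main).
- near=> a.
  have a0 : 0 < a by [].
  have as_ : a < s by near: a; exact: nbhs_right_lt.
  have [H1 H2] := riesz_potential_bounds mu s a x mux0 a0 as_.
  (* Factoring [a] out of both bounds reduces them to [riesz_potential_bounds]; distributivity in
     the extended reals holds as both summands are nonnegative. *)
  rewrite muleCA EFinM -ME -muleDr//; last first.
    apply: ge0_adde_def; rewrite inE ?measure_ge0// mule_ge0//.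
      by rewrite lee_fin subr_ge0 ltW.
    apply: integral_ge0 => r _.
    by rewrite lee_fin mulr_ge0 ?powR_ge0// radial_density_ge0.
  by rewrite !lee_pmul2l// H1.
(* The upper bound exceeds the lower one by [a * M], which vanishes because the total mass is
   finite. *)
- rewrite -[X in _ --> X]add0e; apply: cvgeD => //.
  apply: cvg_EFin; first exact: nearW.
  rewrite -[X in _ --> X](mul0r M); apply: cvgMl.
  by apply: cvg_at_right_filter; exact: cvg_id.
Unshelve. all: by end_near. Qed.
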